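(* Let $n\ge 1$ and let $k_1,\dots,k_n\ge 1$ be integers. Let $\mathcal{M}=\{1^{k_1},2^{k_2},\ldots,n^{k_n}\}$ and $K=k_1+k_2+\cdots+k_n$. For every integer $d\ge 0$, there is a bijection between the set of quasi-Stirling permutations $\pi\in\overline{\mathcal{Q}}_{\mathcal{M}}$ with $des(\pi)=d+1$ and the set of $\sigma\in\mathcal{J}_{K,K-n+1}$ with $exc(\sigma)=d$.
   Context: The notation $\{1^{k_1},\ldots,n^{k_n}\}$ denotes the multiset in which $i$ occurs exactly $k_i$ times. A permutation of a multiset is a linear arrangement (word) of its elements in which each element is used with its multiplicity. A permutation $\pi$ of a multiset is quasi-Stirling if there do not exist indices $i<j<k<\ell$ with $\pi_i=\pi_k$ and $\pi_j=\pi_\ell$. $\overline{\mathcal{Q}}_{\mathcal{M}}$ is the set of quasi-Stirling permutations of the multiset $\mathcal{M}$. For a word $\pi=\pi_1\cdots\pi_N$ of positive integers, with the convention $\pi_0=\pi_{N+1}=0$, $des(\pi)$ is the number of indices $i$, $0\le i\le N$, with $\pi_i>\pi_{i+1}$. $\mathcal{J}_{N,r}$ is the set of words $\sigma=\sigma_1\sigma_2\cdots\sigma_{N-r}$ of length $N-r$ with each $\sigma_i\in[N]=\{1,\ldots,N\}$ and with pairwise distinct entries. For such $\sigma$, $exc(\sigma)$ is the number of excedances, i.e. of indices $i$ (among $1,\ldots,N-r$) with $\sigma_i>i$.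
   Formalization: In the definition of quasi-Stirling the two crossing letters are required to be distinct (avoidance of 1212 and 2121); read literally, four equal letters would be forbidden and the claim would fail for n=1, k_1=4, d=0. *)

(* Defs.v *)
From mathcomp Require Import all_boot.

Set Implicit Arguments.
Unset Strict Implicit.
Unset Printing Implicit Defensive.

(* Words are sequences of natural numbers.  Positions of [nth] start at 0, so
   the letter at the (1-based) position i of w is [nth 0 w i.-1]. *)

(* The multiplicities are indexed from 0: the letter i.+1 occurs k i times. *)
Definition multiset_perm n (k : 'I_n -> nat) : pred (seq nat) :=
  fun w => perm_eq w (flatten [seq nseq (k i) i.+1 | i <- enum 'I_n]).

(* The crossing pair of letters must be distinct (avoidance of the patterns
   1212 and 2121).  Without [nth 0 w a != nth 0 w b], no word with four equal
   letters would be quasi-Stirling. *)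
Definition quasi_stirling : pred (seq nat) := fun w =>
  ~~ [exists a : 'I_(size w), exists b : 'I_(size w),
      exists c : 'I_(size w), exists e : 'I_(size w),
      [&& a < b, b < c, c < e,
          nth 0 w a == nth 0 w c, nth 0 w b == nth 0 w e
        & nth 0 w a != nth 0 w b]].

Definition quasi_stirling_perm n (k : 'I_n -> nat) : pred (seq nat) :=
  fun w => multiset_perm k w && quasi_stirling w.

(* [0 :: rcons w 0] is w_0 w_1 ... w_N w_(N+1) with w_0 = w_(N+1) = 0. *)
Definition des (w : seq nat) : nat :=
  #|[set i : 'I_(size w).+1 |
      nth 0 (0 :: rcons w 0) i > nth 0 (0 :: rcons w 0) i.+1]|.

Definition partial_perm (N r : nat) : pred (seq nat) := fun s =>
  [&& size s == N - r, all (fun x => 1 <= x <= N) s & uniq s].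

Definition exc (s : seq nat) : nat :=
  #|[set i : 'I_(size s) | nth 0 s i > i.+1]|.

(* Main.v *)
Require Import Defs.
From mathcomp Require Import all_boot zify.

(** The idea is to show that the distribution of [des] depends only on the
    number n of distinct letters and on the length K of the word, then to
    treat one convenient multiset.

    Adjoining the letter 0 and closing up the word, a quasi-Stirling
    permutation becomes a noncrossing cyclic word in which 0 occurs once,
    and [des] becomes the number of cyclic descents. In such a word take two
    letters j and i = j + 1, with i occurring at least twice. Cut the circle
    in front of the run of the letters j; the word is j A i X i B, with the
    block X enclosed between the first two copies of i. Sending it
    to j X j A i B is a bijection onto the words with one copy of i replaced
    by a copy of j. It preserves noncrossing words, since X shares no letter with
    the rest ([noncrossing_move]), and cyclic descents, since no letter lies
    strictly between j and j + 1 ([cyclic_des_move]). Repeating such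
    transfers, the multiset becomes m copies of 1 and one copy of each of 2,
    ..., n, with m = K - n + 1 ([equinumerous_normalize]).

    For this multiset every word is noncrossing, and all words are obtained
    from 1 ... 1 by inserting successively 2, ..., n. Inserting a maximal
    letter into a word of length N - 1 with c descents can be done in N
    ways, c of which keep the number of descents while the others increase
    it by one. Injective words of length l on the letters 1, ..., m + l can
    be grown in the same manner, by inserting a new smallest point into the
    cycle structure, and [exc + 1] obeys the same rule ([exc_graft]). Both
    statistics start from the single value 1, so they are equidistributed
    ([perm_des_exc]), and equal cardinalities give the bijection. *)

Set Implicit Arguments.
Unset Strict Implicit.
Unset Printing Implicit Defensive.

(** * Explicit bijections between predicates *)

(** Both directions are total functions on the carrier types, so that bijections
    compose without carrying membership proofs. *)
Definition equinumerous (S T : Type) (P : S -> Prop) (Q : T -> Prop) :=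
  exists (f : S -> T) (g : T -> S),
    [/\ forall x, P x -> Q (f x), forall y, Q y -> P (g y),
        forall x, P x -> g (f x) = x & forall y, Q y -> f (g y) = y].

Lemma equinumerous_sym S T (P : S -> Prop) (Q : T -> Prop) :
  equinumerous P Q -> equinumerous Q P.
Proof. by case=> f [g [? ? ? ?]]; exists g, f. Qed.

Lemma equinumerous_trans S T U (P : S -> Prop) (Q : T -> Prop) (R : U -> Prop) :
  equinumerous P Q -> equinumerous Q R -> equinumerous P R.
Proof.
case=> f [g [PQ QP fK gK]] [f' [g' [QR RQ f'K g'K]]].
exists (f' \o f), (g \o g'); split=> /= [x /PQ/QR | y /RQ/QP | x Px | y Ry] //.
- by rewrite f'K ?fK //; apply: PQ.
- by rewrite gK ?g'K //; apply: RQ.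
Qed.

Lemma equinumerous_iff T (P Q : T -> Prop) :
  (forall x, P x <-> Q x) -> equinumerous P Q.
Proof. by move=> PQ; exists id, id; split=> // x /PQ. Qed.

Lemma equinumerous_sig S T (P : pred S) (Q : pred T) :
  equinumerous P Q -> exists f : {x | P x} -> {y | Q y}, bijective f.
Proof.
case=> f [g [PQ QP fK gK]].
exists (fun u => exist _ (f (val u)) (PQ _ (valP u))).
exists (fun v => exist _ (g (val v)) (QP _ (valP v))) => u;
  apply: val_inj => /=.
- exact: fK (valP u).
- exact: gK (valP u).
Qed.

Lemma equinumerous_seq (S T : eqType) (x0 : S) (y0 : T) (s : seq S)
    (t : seq T) :
  uniq s -> uniq t -> size s = size t ->
  equinumerous (fun x => x \in s) (fun y => y \in t).
Proof.
move=> s_uniq t_uniq eq_sz.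
exists (fun x => nth y0 t (index x s)), (fun y => nth x0 s (index y t)).
split=> [x xs | y yt | x xs | y yt].
- by rewrite mem_nth // -eq_sz index_mem.
- by rewrite mem_nth // eq_sz index_mem.
- by rewrite index_uniq -?eq_sz ?index_mem // nth_index.
- by rewrite index_uniq ?eq_sz ?index_mem // nth_index.
Qed.

(** * Noncrossing words *)

Definition noncrossing (w : seq nat) :=
  forall a b, subseq [:: a; b; a; b] w -> a = b.

Lemma split_first (x : nat) (s : seq nat) :
  x \in s -> exists P R, s = P ++ x :: R /\ x \notin P.
Proof.
move=> xs; exists (take (index x s) s), (drop (index x s).+1 s).
split; last by rewrite in_take // ltnn.
rewrite -[LHS](cat_take_drop (index x s)) (drop_nth 0) ?index_mem //.
by rewrite nth_index.
Qed.

Lemma subseq_split (T : eqType) (t s1 s2 : seq T) :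
  subseq t (s1 ++ s2) ->
  exists t1 t2, [/\ t = t1 ++ t2, subseq t1 s1 & subseq t2 s2].
Proof.
case/subseqP=> m sz_m ->; rewrite -(cat_take_drop (size s1) m) mask_cat.
  exists (mask (take (size s1) m) s1), (mask (drop (size s1) m) s2).
  by split=> //; apply: mask_subseq.
by rewrite size_take sz_m size_cat; case: ltngtP => //; lia.
Qed.

Lemma noncrossing_subseq u w : subseq u w -> noncrossing w -> noncrossing u.
Proof. by move=> uw nw a b abu; apply/nw/(subseq_trans abu uw). Qed.

(** Cutting [a; b; a; b] and exchanging the two parts gives [a; b; a; b] or
    [b; a; b; a]: crossing is a property of cyclic words. *)
Lemma noncrossing_catC s1 s2 : noncrossing (s1 ++ s2) -> noncrossing (s2 ++ s1).
Proof.
move=> nc a b /subseq_split[t1 [t2 [def_t t1s t2s]]].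
have t21: subseq (t2 ++ t1) (s1 ++ s2) by apply: cat_subseq.
case: t1 def_t t21 {t1s t2s} => [|c1 [|c2 [|c3 [|c4 [|c5 t1]]]]] //.
- by move=> /= <-; rewrite cats0 => /nc.
- by case=> <- <- /nc ->.
- by case=> <- <- <- /nc.
- by case=> <- <- <- <- /nc ->.
- by case=> <- <- <- <- <- /nc.
Qed.

Lemma noncrossing_rot k s : noncrossing s -> noncrossing (rot k s).
Proof. by rewrite /rot -{1}(cat_take_drop k s) => /noncrossing_catC. Qed.

(** A contiguous block sharing no letter with its surroundings cannot take part
    in a crossing with them: a letter outside the block cannot separate two
    letters inside it. *)
Lemma noncrossing_block s1 X s2 :
    {in X, forall c, c \notin s1 ++ s2} ->
  noncrossing (s1 ++ X ++ s2) <-> noncrossing X /\ noncrossing (s1 ++ s2).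
Proof.
move=> disjX; split=> [nc | [ncX nc12] a b].
  split; apply: noncrossing_subseq nc.
    exact: subseq_trans (prefix_subseq _ _) (suffix_subseq _ _).
  by rewrite cat_subseq ?suffix_subseq.
case/subseq_split=> t1 [t' [def_t t1s]].
case/subseq_split=> t2 [t3 [def_t' t2s t3s]].
have in1 : all (fun c => c \notin X) t1.
  apply/allP=> c /(mem_subseq t1s) cs1; apply: contraL cs1 => /disjX.
  by rewrite mem_cat; case/norP.
have in3 : all (fun c => c \notin X) t3.
  apply/allP=> c /(mem_subseq t3s) cs2; apply: contraL cs2 => /disjX.
  by rewrite mem_cat; case/norP.
have in2 : all (mem X) t2 by apply/allP=> c /(mem_subseq t2s).
have t13s : subseq (t1 ++ t3) (s1 ++ s2) by apply: cat_subseq.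
have [aX | aX] := boolP (a \in X); have [bX | bX] := boolP (b \in X).
- apply: ncX; rewrite def_t def_t'.
  have allX : all (mem X) [:: a; b; a; b] by rewrite /= aX bX.
  have none t : all (mem X) t -> all (fun c => c \notin X) t -> t = [::].
    by case: t => //= c t /andP[-> _].
  move: allX; rewrite def_t def_t' !all_cat => /and3P[a1 _ a3].
  by rewrite (none t1) // (none t3) // cats0.
(* If only a is in X, the part of [a; b; a; b] inside X starts with its first
   letter, has to stop before b, and leaves the second a outside. *)
- case: t1 def_t in1 {t1s t13s} => [|c t1] /= [].
    subst t'; case: t2 in2 {t2s} => [|c [|d t2]] /=.
    + by move=> _ def_t; move: in3; rewrite -def_t /= aX.
    + by move=> _ [_ def_t]; move: in3; rewrite -def_t /= aX !andbF.
    + by case/and3P=> _ dX _ [_ db _]; move: dX; rewrite -db (negPf bX).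
  by move=> <- _; rewrite aX.
(* If only b is in X, the part inside X extends from the first b to the last,
   hence contains an a. *)
- case: t1 def_t in1 {t1s t13s} => [|c [|d t1]] /=.
  + subst t'; case: t2 in2 {t2s} => [|c t2] /=.
      by move=> _ def_t; move: in3; rewrite -def_t /= bX !andbF.
    by case/andP=> cX _ [ca _]; move: cX; rewrite -ca (negPf aX).
  + subst t'; case: t2 in2 {t2s} => [|c' [|d t2]] /=.
    * by move=> _ [_ def_t]; move: in3; rewrite -def_t /= bX.
    * by move=> _ [_ _ def_t]; move: in3; rewrite -def_t /= bX !andbF.
    * by case/and3P=> _ dX _ [_ _ da _]; move: dX; rewrite -da (negPf aX).
  + by case=> _ <- _; rewrite bX andbF.
- apply: nc12; rewrite def_t def_t'.
  have allX : all (fun c => c \notin X) [:: a; b; a; b] by rewrite /= aX bX.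
  move: allX; rewrite def_t def_t' !all_cat => /and3P[_ a2 _].
  by case: t2 in2 a2 {def_t' t2s} => //= c t2 /andP[->].
Qed.

(** A subword [a; b; a; b] with a <> b uses at most one of two adjacent equal
    letters. *)
Lemma noncrossing_double s1 c s2 :
  noncrossing (s1 ++ c :: c :: s2) <-> noncrossing (s1 ++ c :: s2).
Proof.
split=> nc.
  apply: noncrossing_subseq nc.
  by apply: cat_subseq => //; apply: subseq_cons.
move=> a b; rewrite -[c :: c :: s2]/([:: c; c] ++ s2).
case/subseq_split=> t1 [t' [def_t t1s]].
case/subseq_split=> t2 [t3 [def_t' t2s t3s]].
have [t2c | t2cc] : subseq t2 [:: c] \/ t2 = [:: c; c].
- have /all_pred1P -> : all (pred1 c) t2.
    by apply/allP=> x /(mem_subseq t2s); rewrite !inE orbb.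
  case: (size t2) (size_subseq t2s) => [|[|[|m]]] //= _; last by right.
    by left.
  by left; rewrite eqxx.
- apply: nc; rewrite def_t def_t' -[c :: s2]/([:: c] ++ s2).
  by do 2!apply: cat_subseq => //.
- move: def_t; rewrite def_t' t2cc.
  by case: t1 {t1s} => [|? [|? [|? [|? []]]]] // [] *; subst.
Qed.

(** Four increasing positions carrying a, b, a, b are the same data as a subword
    [a; b; a; b]; subwords are stable under concatenation, which positions are
    not. *)
Lemma quasi_stirlingP w : reflect (noncrossing w) (quasi_stirling w).
Proof.
apply: (iffP negP) => [qs a b abab | nc].
  have pos (x : nat) (s t : seq nat) : subseq (x :: s) t ->
      exists p, [/\ p < size t, nth 0 t p = x & subseq s (drop p.+1 t)].
    elim: t => //= y t IHt; case: eqVneq => [-> st | _ /IHt[p [? ? ?]]].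
      by exists 0; rewrite drop0.
    by exists p.+1.
  have{abab} [p1 [lt1 def1 /pos[p2 []]]] := pos _ _ _ abab.
  rewrite size_drop nth_drop drop_drop => lt2 def2 /pos[p3 []].
  rewrite size_drop nth_drop drop_drop => lt3 def3 /pos[p4 []].
  rewrite size_drop nth_drop => lt4 def4 _.
  apply/eqP; apply: contraT => neq_ab; case: qs.
  have h1 : p1 < size w by [].
  have h2 : p1.+1 + p2 < size w by lia.
  have h3 : p2.+1 + p1.+1 + p3 < size w by lia.
  have h4 : p3.+1 + (p2.+1 + p1.+1) + p4 < size w by lia.
  apply/existsP; exists (Ordinal h1); apply/existsP; exists (Ordinal h2).
  apply/existsP; exists (Ordinal h3); apply/existsP; exists (Ordinal h4).
  by rewrite /= def1 def2 def3 def4 !eqxx neq_ab; lia.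
case/existsP=> -[a ha] /existsP[[b hb]] /existsP[[c hc]] /existsP[[e he]] /=.
case/and5P=> ab bc ce /eqP eq_ac /andP[/eqP eq_be /eqP []].
apply: nc; rewrite {2}eq_ac {2}eq_be.
have step p q s : q <= p -> p < size w ->
    subseq s (drop p.+1 w) -> subseq (nth 0 w p :: s) (drop q w).
  move=> qp pw sub_s; apply: (@subseq_trans _ (drop p w)); last first.
    by rewrite -{1}(subnK qp) -drop_drop; apply: drop_subseq.
  by rewrite (drop_nth 0 pw) /= eqxx.
rewrite -[w in subseq _ w]drop0; do 4?apply: (step) => //; apply: sub0seq.
Qed.

(** * Cyclic descents and cyclic words *)

Definition descents x s := sumn (pairmap (fun a b : nat => b < a : nat) x s).

(** The letter preceding the first one is the last one, so that every cyclically
    consecutive pair is counted once. *)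
Definition cyclic_des s := descents (last 0 s) s.

Lemma descents_cat x s t :
  descents x (s ++ t) = descents x s + descents (last x s) t.
Proof. by rewrite /descents pairmap_cat sumn_cat. Qed.

Lemma descents_cons x y s : descents x (y :: s) = (y < x) + descents y s.
Proof. by []. Qed.

Lemma des_descents w : des w = descents 0 (rcons w 0).
Proof.
rewrite /des cardsE -sum1_card big_mkcond /descents sumnE.
rewrite (big_nth 0) big_mkord size_pairmap size_rcons.
by apply: eq_bigr => i _; rewrite (nth_pairmap 0) ?size_rcons //.
Qed.

(** The two boundary zeros of the definition of [des] are one and the same zero
    when the word is closed up into a circle. *)
Lemma des_cyclic w : des w = cyclic_des (0 :: w).
Proof.
rewrite des_descents -cats1 descents_cat addnC /cyclic_des.
by rewrite !descents_cons addn0.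
Qed.

Lemma cyclic_des_rot k s : cyclic_des (rot k s) = cyclic_des s.
Proof.
rewrite /rot -[in RHS](cat_take_drop k s).
case: (take k s) (drop k s) => [|x s1] [|y s2]; rewrite ?cats0 //.
by rewrite /cyclic_des !descents_cat !last_cat /= addnC.
Qed.

Lemma rot_rot_exists m n (s : seq nat) : exists k, rot m (rot n s) = rot k s.
Proof.
have [le_ms | /ltnW lt_sm] := leqP m (size s); last first.
  by exists n; rewrite (@rot_oversize _ m) ?size_rot.
have [le_ns | /ltnW lt_sn] := leqP n (size s).
  by rewrite rot_add_mod //; eexists.
by exists m; rewrite (@rot_oversize _ n).
Qed.

(** A letter of multiplicity one marks where a cyclic word is to be cut. *)
Lemma rot_index_uniq (x : nat) s u k :
  x \notin s -> u = rot k (x :: s) -> rot (index x u) u = x :: s.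
Proof.
move=> xNs def_u.
have xu : x \in u by rewrite def_u mem_rot mem_head.
rewrite (rot_index xu); set t := _ ++ _.
have [k' def_t]: exists k', x :: t = rot k' (x :: s).
  by rewrite -rot_index // {2}def_u; apply: rot_rot_exists.
move: def_t; rewrite /rot; case: k' => [|k'] /=; first by rewrite cats0.
case def_d: (drop k' s) => [|y d] /= [] //.
  move=> ->; have /eqP := congr1 size def_d.
  by rewrite size_drop subn_eq0 => /take_oversize->.
move=> /esym def_y; move: xNs; rewrite -(cat_take_drop k' s) def_d def_y.
by rewrite mem_cat mem_head orbT.
Qed.

Definition qs M D w := [/\ perm_eq w M, noncrossing w & des w = D].

Definition cyclic_qs M D u :=
  [/\ perm_eq u (0 :: M), noncrossing u & cyclic_des u = D].

(** In a noncrossing cyclic word the letters i and j, with all others erased,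
    form a single run of j followed by a single run of i.  An anchored rotation
    is the one cut in front of the run of j. *)
Definition anchored (i j : nat) u :=
  (head 0 u == j) && (j \notin drop (index i u) u).

(** From an occurrence of i, go on to the next j: this is the start of the run
    of j. *)
Definition anchor i j (s : seq nat) :=
  let s1 := rot (index i s) s in rot (index j s1) s1.

Lemma anchor_rot i j s : exists k, anchor i j s = rot k s.
Proof. exact: rot_rot_exists. Qed.

Lemma anchor_anchored (i j : nat) (s : seq nat) :
  i != j -> i \in s -> j \in s -> noncrossing s -> anchored i j (anchor i j s).
Proof.
move=> neq_ij si sj nc; have := @noncrossing_rot (index i s) s nc.
rewrite /anchor /anchored rot_index //; set t := _ ++ _.
have : j \in i :: t by rewrite /t -rot_index // mem_rot.
rewrite in_cons eq_sym (negPf neq_ij) /= => /[dup] jt /rot_index + ncr.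
set s1 := i :: t in ncr *.
have js1 : j \in s1 by rewrite in_cons jt orbT.
have def_ix : index j s1 = (index j t).+1 by rewrite /= (negPf neq_ij).
move=> _; have nc2 := @noncrossing_rot (index j s1) s1 ncr.
move: nc2; rewrite rot_index // def_ix /= eqxx /=.
set Q := drop _ t; set P := take _ t.
have jP : j \notin P by rewrite /P in_take // ltnn.
rewrite eq_sym (negPf neq_ij) index_cat /= => nc2.
case: ifP => [iQ | _]; last first.
  by rewrite eqxx addn0 drop_size_cat // in_cons negb_or eq_sym neq_ij.
have ltQ : index i Q < size Q by rewrite index_mem.
rewrite drop_cat ltQ mem_cat in_cons negb_or eq_sym negb_or neq_ij jP !andbT /=.
(* A j of Q after its first i would make the subword j i j i. *)
apply: contra (neq_ij) => jQ; apply/eqP/esym/nc2; rewrite /= eqxx.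
rewrite -[Q](cat_take_drop (index i Q)) -catA.
apply: subseq_trans (suffix_subseq _ _).
rewrite (drop_nth 0) // nth_index //= eqxx.
have jQ' : j \in drop (index i Q).+1 Q.
  move: jQ; rewrite (drop_nth 0) // nth_index //.
  by rewrite in_cons eq_sym (negPf neq_ij).
rewrite -[[:: j; i]]/([:: j] ++ [:: i]).
by apply: cat_subseq; rewrite sub1seq ?mem_head.
Qed.

(** If two distinct anchored cuts split the circle into two arcs, both arcs
    begin with j; whichever arc contains i then has a j following it. *)
Lemma anchored_uniq (i j : nat) (u : seq nat) k :
  i \in u -> anchored i j u -> anchored i j (rot k u) -> rot k u = u.
Proof.
rewrite /rot -{1 2 7}(cat_take_drop k u).
case: (take k u) (drop k u) => [|x u1] [|y u2]; rewrite ?cats0 //.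
rewrite /anchored mem_cat => iu /andP[/eqP def_x j1] /andP[/eqP def_y j2].
have{} def_x : x = j := def_x; have{} def_y : y = j := def_y.
exfalso; subst x y; case/orP: iu => [i1 | i2].
- move: j1; rewrite index_cat i1 drop_cat index_mem i1.
  by rewrite mem_cat mem_head orbT.
- move: j2; rewrite index_cat i2 drop_cat index_mem i2.
  by rewrite mem_cat mem_head orbT.
Qed.

Lemma noncrossing_cons x w :
  x \notin w -> noncrossing (x :: w) <-> noncrossing w.
Proof.
move=> xNw; rewrite -[x :: w]/([::] ++ [:: x] ++ w) noncrossing_block.
  by split=> [[] | nc] //; split=> // a b /size_subseq.
by move=> c; rewrite inE => /eqP ->.
Qed.

(** Both sides cut the same cyclic words on the letters 0 and M: on the left the
    cut is at the only 0, on the right it is at the run of j. *)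
Lemma equinumerous_anchored M D i j :
    0 \notin M -> i != j -> i \in M -> j \in M ->
  equinumerous (qs M D) (fun u => cyclic_qs M D u /\ anchored i j u).
Proof.
move=> M0 neq_ij Mi Mj.
have nz w : perm_eq w M -> 0 \notin w by move=> /perm_mem->.
exists (fun w => anchor i j (0 :: w)), (fun u => behead (rot (index 0 u) u)).
have zero u : cyclic_qs M D u ->
    exists w, rot (index 0 u) u = 0 :: w /\ perm_eq w M.
  case=> uM _ _; have u0 : 0 \in u by rewrite (perm_mem uM) mem_head.
  rewrite rot_index //; eexists; split; first by [].
  by rewrite -(perm_cons 0) -rot_index // perm_rot.
split.
- move=> w [wM nc desw]; split.
    have [k ->] := anchor_rot i j (0 :: w); split.
    + by rewrite perm_rot perm_cons.
    + by apply: noncrossing_rot; rewrite noncrossing_cons ?nz.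
    + by rewrite cyclic_des_rot -des_cyclic.
  apply: anchor_anchored; rewrite ?in_cons ?(perm_mem wM) ?Mi ?Mj ?orbT //.
  by rewrite noncrossing_cons ?nz.
- move=> u [cu _]; have [w [def_w wM]] := zero u cu; case: cu => uM nc desu.
  rewrite def_w /=; split=> //.
    by rewrite -(noncrossing_cons (nz w wM)) -def_w; apply: noncrossing_rot.
  by rewrite des_cyclic -def_w cyclic_des_rot.
- move=> w [wM _ _]; have [k def_a] := anchor_rot i j (0 :: w).
  by rewrite (rot_index_uniq (nz w wM) def_a).
- move=> u [cu au]; have [w [def_w wM]] := zero u cu; case: cu => uM nc desu.
  have iu : i \in u by rewrite (perm_mem uM) in_cons Mi orbT.
  have ju : j \in u by rewrite (perm_mem uM) in_cons Mj orbT.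
  rewrite def_w /= -def_w.
  have [k1 def_k1] := anchor_rot i j (rot (index 0 u) u).
  have [k def_k] := rot_rot_exists k1 (index 0 u) u.
  rewrite def_k1 def_k; apply: (anchored_uniq iu au).
  rewrite -def_k -def_k1; apply: anchor_anchored; rewrite ?mem_rot //.
  exact: noncrossing_rot.
Qed.

(** * Moving one copy of a letter *)

(** The block X sits between two copies of i on the left and between two copies
    of j on the right.  Either way, a letter common to X and to the rest would
    cross i or j, so X is disjoint from the rest and can be deleted; the doubled
    letter that remains can then be merged, and both words reduce to
    [j :: A ++ i :: B]. *)
Lemma noncrossing_move (i j : nat) (X A B : seq nat) :
    i \notin X -> j \notin X ->
  noncrossing (j :: A ++ i :: X ++ i :: B) <->
  noncrossing (j :: X ++ j :: A ++ i :: B).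
Proof.
move=> iX jX; set rest := j :: A ++ i :: B.
have neqi c : c \in X -> c != i by apply: contraL => /eqP->.
have neqj c : c \in X -> c != j by apply: contraL => /eqP->.
have disj1 : noncrossing (j :: A ++ i :: X ++ i :: B) ->
    {in X, forall c, c \notin rest}.
  move=> nc c cX; have /eqP neq_ci := neqi c cX.
  rewrite in_cons mem_cat in_cons (negPf (neqi c cX)) (negPf (neqj c cX)) /=.
  rewrite -sub1seq in cX.
  apply/norP; split; rewrite -sub1seq; apply/negP => cAB.
    apply: neq_ci; apply: nc; apply: subseq_trans (subseq_cons _ _).
    rewrite -[[:: c; i; c; i]]/([:: c] ++ [:: i] ++ [:: c] ++ [:: i]).
    rewrite -[i :: X ++ i :: B]/([:: i] ++ X ++ [:: i] ++ B).
    by do 3?apply: cat_subseq => //; apply: prefix_subseq.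
  apply/neq_ci/esym/nc.
  apply: subseq_trans (subseq_cons _ _).
  apply: subseq_trans (suffix_subseq _ _).
  rewrite -[[:: i; c; i; c]]/([:: i] ++ [:: c] ++ [:: i] ++ [:: c]).
  rewrite -[i :: X ++ i :: B]/([:: i] ++ X ++ [:: i] ++ B).
  by do 3?apply: cat_subseq => //.
have disj2 : noncrossing (j :: X ++ rest) -> {in X, forall c, c \notin rest}.
  move=> nc c cX; rewrite in_cons (negPf (neqj c cX)) /=; apply/negP => cAB.
  have /eqP[] := neqj c cX; apply/esym/nc; rewrite -sub1seq in cX.
  rewrite -[[:: j; c; j; c]]/([:: j] ++ [:: c] ++ [:: j] ++ [:: c]).
  rewrite -[j :: X ++ rest]/([:: j] ++ X ++ [:: j] ++ A ++ i :: B).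
  by do 3?apply: cat_subseq => //; rewrite sub1seq.
have def_w : j :: A ++ i :: X ++ i :: B = (j :: rcons A i) ++ X ++ i :: B.
  by rewrite /= cat_rcons.
rewrite def_w in disj1 *.
have dbl1 : noncrossing ((j :: rcons A i) ++ i :: B) <-> noncrossing rest.
  rewrite (_ : _ ++ _ = (j :: A) ++ i :: i :: B) ?noncrossing_double //.
  by rewrite /= cat_rcons.
have dbl2 : noncrossing ([:: j] ++ rest) <-> noncrossing rest.
  exact: (noncrossing_double [::]).
have blk1 : {in X, forall c, c \notin rest} ->
    noncrossing ((j :: rcons A i) ++ X ++ i :: B) <->
    noncrossing X /\ noncrossing ((j :: rcons A i) ++ i :: B).
  move=> disj; apply: noncrossing_block => c /disj.
  by rewrite /rest !(in_cons, mem_cat, mem_rcons); lia.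
have blk2 : {in X, forall c, c \notin rest} ->
    noncrossing ([:: j] ++ X ++ rest) <->
    noncrossing X /\ noncrossing ([:: j] ++ rest).
  move=> disj; apply: noncrossing_block => c /disj.
  by rewrite /rest !(in_cons, mem_cat, in_nil); lia.
split=> nc.
- have d := disj1 nc; apply/(blk2 d); case/(blk1 d): nc => ncX nc.
  by split=> //; apply/dbl2/dbl1.
- have d := disj2 nc; apply/(blk1 d); case/(blk2 d): nc => ncX nc.
  by split=> //; apply/dbl1/dbl2.
Qed.

(** Every letter other than j and j + 1 compares in the same way with both, so
    descents cannot tell which of them surrounds X. *)
Lemma descents_block (j : nat) (X : seq nat) :
    j \notin X -> j.+1 \notin X ->
  descents j X + (j < last j X) = descents j.+1 X + (j.+1 < last j.+1 X).
Proof.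
case: X => [|x X] jX iX; first by rewrite /= !ltnn.
rewrite !descents_cons /=; set z := last x X.
have zX : z \in x :: X by apply: mem_last.
have zj : z != j by apply: contraNneq jX => <-.
have zi : z != j.+1 by apply: contraNneq iX => <-.
by move: jX iX; rewrite !in_cons; lia.
Qed.

Lemma cyclic_des_move (j : nat) (X A B : seq nat) :
    j \notin X -> j.+1 \notin X ->
  cyclic_des (j :: A ++ j.+1 :: X ++ j.+1 :: B) =
  cyclic_des (j :: X ++ j :: A ++ j.+1 :: B).
Proof.
move=> jX iX; have := descents_block jX iX; rewrite /cyclic_des /=.
rewrite !(last_cat, last_cons, descents_cons, descents_cat).
by move=> eqX; lia.
Qed.

Lemma drop_index_cat (x : nat) (P R : seq nat) :
  x \notin P -> drop (index x (P ++ x :: R)) (P ++ x :: R) = x :: R.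
Proof.
by move=> xP; rewrite index_cat (negPf xP) /= eqxx addn0 drop_size_cat.
Qed.

(** First occurrences are the right delimiters, because the blocks in front of
    them avoid the delimiting letters. *)
Definition parse (x y : nat) (s : seq nat) :=
  let t := behead s in
  let t' := drop (index x t).+1 t in
  (take (index x t) t, take (index y t') t', drop (index y t').+1 t').

Lemma parse_cat x y c (P Q R : seq nat) :
    x \notin P -> y \notin Q ->
  parse x y (c :: P ++ x :: Q ++ y :: R) = (P, Q, R).
Proof.
move=> xP yQ; rewrite /parse /= index_cat (negPf xP) /= eqxx addn0.
rewrite take_size_cat //.
have -> : drop (size P).+1 (P ++ x :: Q ++ y :: R) = Q ++ y :: R.
  by rewrite -cat_rcons drop_size_cat ?size_rcons.
rewrite index_cat (negPf yQ) /= eqxx addn0 take_size_cat //.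
by rewrite -cat_rcons drop_size_cat ?size_rcons.
Qed.

(** Draw a noncrossing cyclic word as a tree of polygons: a letter with k copies
    is a polygon with k vertices, and the descents are read off around the
    vertices.  The bijection detaches one vertex of the polygon j + 1, with
    everything that hangs from it, and attaches it to the polygon j.  For an
    anchored word this is j A i X i B <-> j X j A i B, where i = j + 1: the
    vertex is the one between the first two copies of i, respectively the first
    two copies of j. *)
Lemma equinumerous_move (j D : nat) (M : seq nat) :
  equinumerous
    (fun u => cyclic_qs (j.+1 :: j.+1 :: j :: M) D u /\ anchored j.+1 j u)
    (fun u => cyclic_qs (j.+1 :: j :: j :: M) D u /\ anchored j.+1 j u).
Proof.
set i := j.+1; set CP := (fun u => _); set CQ := (fun u => _).
have neq_ij : i != j by rewrite /i; lia.
pose P' (t : seq nat * seq nat * seq nat) :=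
  let: (A, X, B) := t in j :: A ++ i :: X ++ i :: B.
pose Q' (t : seq nat * seq nat * seq nat) :=
  let: (X, A, B) := t in j :: X ++ j :: A ++ i :: B.
(* With these conditions both words are anchored, and the displayed copies of i
   and j are the first ones, which makes the blocks unique. *)
pose good (X A B : seq nat) :=
  [/\ i \notin A, i \notin X, j \notin X & j \notin B].
have equiv X A B : good X A B -> CP (P' (A, X, B)) <-> CQ (Q' (X, A, B)).
  case=> iA iX jX jB; rewrite /CP /CQ /P' /Q'.
  have aP : anchored i j (P' (A, X, B)).
    rewrite /anchored /P' eqxx -cat_cons drop_index_cat; last first.
      by rewrite in_cons negb_or neq_ij.
    rewrite in_cons mem_cat in_cons negb_or eq_sym neq_ij.
    by rewrite negb_or jX negb_or neq_ij.
  have aQ : anchored i j (Q' (X, A, B)).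
    rewrite /anchored /Q' eqxx -!cat_cons catA drop_index_cat; last first.
      by rewrite mem_cat !in_cons !negb_or neq_ij iX.
    by rewrite in_cons negb_or eq_sym neq_ij.
  have nc := noncrossing_move A B iX jX.
  have cd := cyclic_des_move A B jX iX.
  have pm : perm_eq (P' (A, X, B)) (0 :: i :: i :: j :: M) =
            perm_eq (Q' (X, A, B)) (0 :: i :: j :: j :: M).
    pose N := j :: X ++ A ++ i :: B; pose N0 := 0 :: i :: j :: M.
    have pP : perm_eq (P' (A, X, B)) (i :: N).
      by apply/permP=> a; do 4?rewrite /= ?count_cat; lia.
    have pQ : perm_eq (Q' (X, A, B)) (j :: N).
      by apply/permP=> a; do 4?rewrite /= ?count_cat; lia.
    have p0 (x : nat) : perm_eq (0 :: i :: x :: j :: M) (x :: N0).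
      by apply/permP=> a; rewrite /N0 /=; lia.
    rewrite (permPl pP) (permPl pQ) (permPr (p0 i)) (permPr (p0 j)).
    by rewrite !perm_cons.
  rewrite /cyclic_qs -/(P' (A, X, B)) -/(Q' (X, A, B)) pm -/i in nc cd *.
  split=> [[[p n e] _]|[[p n e] _]]; split=> //; split=> //.
  - exact/nc.
  - by rewrite -cd.
  - exact/nc.
  - by rewrite /P' cd.
have exP u : CP u -> exists A X B, good X A B /\ u = P' (A, X, B).
  case=> -[uM _ _] /andP[]; case: u uM => [/perm_size//|c t] uM /= /eqP def_c.
  subst c => jN.
  have := permP uM (pred1 i).
  rewrite /= eqxx [j == i]eq_sym (negPf neq_ij) => /= ct.
  have {}ct : count_mem i t = (count_mem i M).+2 := ct.
  have /split_first[A [t2 [def_t iA]]] : i \in t.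
    by rewrite -has_pred1 has_count ct.
  have /split_first[X [B [def_t2 iX]]] : i \in t2.
    rewrite -has_pred1 has_count.
    move: ct; rewrite def_t count_cat /= eqxx (count_memPn iA) => -[].
    by rewrite add0n => ->.
  exists A, X, B; rewrite /P' def_t def_t2; split=> //.
  move: jN; rewrite eq_sym (negPf neq_ij) /= def_t drop_index_cat // def_t2.
  by rewrite in_cons mem_cat in_cons !negb_or => /and4P[].
have exQ u : CQ u -> exists X A B, good X A B /\ u = Q' (X, A, B).
  case=> -[uM _ _] /andP[]; case: u uM => [/perm_size//|c t] uM /= /eqP def_c.
  subst c => jN.
  have := permP uM (pred1 j); rewrite /= eqxx (negPf neq_ij) => /= ct.
  have {}ct : 0 < count_mem j t.
    by move: ct; case: (0 == j) => -[]; rewrite add0n => ->.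
  have /split_first[X [t2 [def_t jX]]] : j \in t.
    by rewrite -has_pred1 has_count ct.
  have := perm_mem uM i; rewrite !in_cons (negPf neq_ij) eqxx orbT /= => it.
  move: jN; rewrite eq_sym (negPf neq_ij) /= def_t => jN.
  have iX : i \notin X.
    apply: contraL jN => iX; rewrite negbK index_cat iX drop_cat index_mem iX.
    by rewrite mem_cat mem_head orbT.
  have /split_first[A [B [def_t2 iA]]] : i \in t2.
    by move: it; rewrite def_t mem_cat in_cons (negPf iX) (negPf neq_ij).
  exists X, A, B; rewrite /Q' def_t2; split=> //; split=> //.
  move: jN; rewrite def_t2 -cat_cons catA drop_index_cat.
    by rewrite in_cons negb_or => /andP[].
  by rewrite mem_cat in_cons !negb_or iX neq_ij.
have parseP X A B : good X A B -> parse i i (P' (A, X, B)) = (A, X, B).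
  by case=> ? ? ? ?; apply: parse_cat.
have parseQ X A B : good X A B -> parse j i (Q' (X, A, B)) = (X, A, B).
  by case=> ? ? ? ?; apply: parse_cat.
pose swap (t : seq nat * seq nat * seq nat) := let: (A, X, B) := t in (X, A, B).
exists (fun u => Q' (swap (parse i i u))), (fun u => P' (swap (parse j i u))).
split=> u => [Pu | Qu | Pu | Qu].
- have [A [X [B [gd def_u]]]] := exP u Pu; subst u.
  by rewrite parseP //; apply/equiv.
- have [X [A [B [gd def_u]]]] := exQ u Qu; subst u.
  by rewrite parseQ //; apply/equiv.
- have [A [X [B [gd def_u]]]] := exP u Pu; subst u.
  by rewrite parseP // -[swap (A, X, B)]/(X, A, B) parseQ.
- have [X [A [B [gd def_u]]]] := exQ u Qu; subst u.
  by rewrite parseQ // -[swap (X, A, B)]/(A, X, B) parseP.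
Qed.

Lemma qs_perm M M' D : perm_eq M M' -> equinumerous (qs M D) (qs M' D).
Proof.
move=> MM'; apply: equinumerous_iff => w.
by split=> -[wM nc e]; split=> //; rewrite (perm_trans wM) // perm_sym.
Qed.

(** Close up the words and cut them at the run of j, move one copy of the letter,
    then cut again at 0. *)
Lemma equinumerous_transfer (j D : nat) (M : seq nat) :
    0 < j -> 0 \notin M ->
  equinumerous (qs (j.+1 :: j.+1 :: j :: M) D) (qs (j.+1 :: j :: j :: M) D).
Proof.
move=> j_gt0 M0; have j0 : 0 != j by rewrite neq_ltn j_gt0.
have ji : j.+1 != j by lia.
apply: equinumerous_trans (equinumerous_anchored D _ ji _ _) _;
  rewrite ?inE ?eqxx ?orbT //; first by rewrite !negb_or j0 M0.
apply: equinumerous_trans (equinumerous_move j D M) _.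
apply/equinumerous_sym/equinumerous_anchored;
  by rewrite ?inE ?eqxx ?orbT //; rewrite !negb_or j0 M0.
Qed.

(** * Reduction to a multiset with a single repeated letter *)

Lemma perm_nseq_iota (M : seq nat) n :
    0 < n -> M =i iota 1 n -> (forall x, 1 < x -> count_mem x M <= 1) ->
  perm_eq M (nseq (size M - n.-1) 1 ++ iota 2 n.-1).
Proof.
move=> n_gt0 memM M1.
have pM : perm_eq M (nseq (count_mem 1 M) 1 ++ iota 2 n.-1).
  apply/allP=> x _ /=; rewrite count_cat count_nseq.
  rewrite (count_uniq_mem x (iota_uniq 2 n.-1)) mem_iota /=.
  have [-> | x1] := eqVneq x 1; first by rewrite mul1n addn0.
  rewrite mul0n add0n; apply/eqP.
  have := memM x; rewrite mem_iota -has_pred1 has_count => /= cx.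
  have [x2 | ] := ltnP 1 x; last by move: (count_mem x M) cx => c; lia.
  by move: (count_mem x M) cx (M1 x x2) => c; lia.
have := perm_size pM; rewrite size_cat size_nseq size_iota => sizeM.
by rewrite sizeM addnK.
Qed.

(** Iterating the transfer pushes all repetitions down to the letter 1; the sum
    of the letters decreases, hence termination. *)
Lemma equinumerous_normalize (M : seq nat) n D :
    0 < n -> M =i iota 1 n ->
  equinumerous (qs M D) (qs (nseq (size M - n.-1) 1 ++ iota 2 n.-1) D).
Proof.
move=> n_gt0; have [m] := ubnP (sumn M); elim: m M => // m IHm M ltm memM.
have [/allP M1 | /allPn[x xM]] :=
    boolP (all (fun x => (1 < x) ==> (count_mem x M <= 1)) M).
  apply/qs_perm/perm_nseq_iota => // x x1.
  have [xM | /count_memPn -> //] := boolP (x \in M).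
  by have := M1 x xM; rewrite x1.
rewrite negb_imply -ltnNge => /andP[x1 cx].
case: x x1 cx xM => // j j_gt0 cx xM; have {}j_gt0 : 0 < j by [].
have jM : j \in M by move: xM; rewrite !memM !mem_iota; lia.
have ji : j != j.+1 by lia.
have M0 : 0 \notin M by rewrite memM mem_iota.
have p1 := perm_to_rem xM; set M1 := rem j.+1 M in p1.
have jM1 : j.+1 \in M1.
  rewrite -has_pred1 has_count; move: cx.
  by rewrite (permP p1 (pred1 j.+1)) /= eqxx.
have p2 := perm_to_rem jM1; set M2 := rem j.+1 M1 in p2.
have jM2 : j \in M2.
  by move: jM; rewrite (perm_mem p1) in_cons (perm_mem p2) in_cons (negPf ji).
have p3 := perm_to_rem jM2; set M3 := rem j M2 in p3.
have pM : perm_eq M (j.+1 :: j.+1 :: j :: M3).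
  apply: perm_trans p1 _; rewrite perm_cons; apply: perm_trans p2 _.
  by rewrite perm_cons.
have M30 : 0 \notin M3.
  by apply: contraNN M0 => M30; rewrite (perm_mem pM) !in_cons M30 !orbT.
apply: equinumerous_trans (qs_perm D pM) _.
apply: equinumerous_trans (equinumerous_transfer D j_gt0 M30) _.
have -> : size M = size (j.+1 :: j :: j :: M3) by rewrite (perm_size pM).
apply: IHm => [|x].
  by move: ltm; have := perm_sumn pM; rewrite /=; lia.
rewrite -memM (perm_mem pM) !in_cons.
by case: (x == j.+1); case: (x == j).
Qed.

(** * Inserting a maximal letter into a word *)

Definition insert_at g x (w : seq nat) := take g w ++ x :: drop g w.

(** Gap g lies in front of position g; the default values of [head] and [last]
    supply the boundary zeros. *)
Definition descent_gap (w : seq nat) g := head 0 (drop g w) < last 0 (take g w).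

Lemma count_descent_gap w : count (descent_gap w) (iota 0 (size w).+1) = des w.
Proof.
rewrite /des cardsE -sum1_card big_mkcond -sum1_count [LHS]big_mkcond.
rewrite -/(index_iota 0 (size w).+1) big_mkord; apply: eq_bigr => -[i lei] _.
suff -> : descent_gap w i = (nth 0 (rcons w 0) i < nth 0 (0 :: rcons w 0) i).
  by rewrite unfold_in.
rewrite /descent_gap -nth0 nth_drop addn0; congr (_ < _).
  by rewrite nth_rcons; case: ltnP => // wi; rewrite if_same nth_default.
case: i lei => [_ | p lep] /=; first by rewrite take0.
by rewrite (last_nth 0) size_takel //= nth_take // nth_rcons -ltnS lep.
Qed.

(** A maximal letter creates exactly one descent, just after itself, and
    destroys the descent of the gap it is put into, if there was one. *)
Lemma des_insert_at g x w :
  all (fun y => y < x) w -> 0 < x ->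
  des (insert_at g x w) = des w + ~~ descent_gap w g.
Proof.
rewrite -{1}(cat_take_drop g w) all_cat => /andP[w1x w2x] x_gt0.
rewrite !des_descents /descent_gap /insert_at -[in rcons w 0](cat_take_drop g w).
rewrite !rcons_cat !descents_cat.
have last_x : last 0 (take g w) < x.
  by case: (take g w) w1x => // y w1 /allP-> //; apply: mem_last.
rewrite rcons_cons descents_cons (leq_gtF (ltnW last_x)) add0n -addnA.
congr (_ + _).
case: (drop g w) w2x => [_ | y w2 /= /andP[yx _]]; rewrite !descents_cons.
  by rewrite x_gt0; case: (_ < _).
by rewrite yx; case: (y < _) => /=; lia.
Qed.

(** * Excedances of injective words *)

(** The values taken at excedances are listed, and not merely counted, since
    grafting a point redirects the arrow with a given value; p is the position
    of the first letter. *)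
Fixpoint exceeding p (s : seq nat) :=
  if s is x :: s' then (if p < x then [:: x] else [::]) ++ exceeding p.+1 s'
  else [::].

Lemma exc_exceeding s : exc s = size (exceeding 1 s).
Proof.
have gen p : size (exceeding p.+1 s) = \sum_(i < size s) (p + i.+1 < nth 0 s i).
  elim: s p => [|x s IHs] p; first by rewrite big_ord0.
  rewrite big_ord_recl /= size_cat IHs addn1; congr (_ + _); first by case: ifP.
  by apply: eq_bigr => i _; rewrite addSnnS.
rewrite gen /exc cardsE -sum1_card big_mkcond.
by apply: eq_bigr => i _; rewrite unfold_in.
Qed.

Lemma exceeding_subseq p s : subseq (exceeding p s) s.
Proof.
elim: s p => //= x s IHs p; case: ifP => _ /=; first by rewrite eqxx.
exact: subseq_trans (IHs _) (subseq_cons _ _).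
Qed.

Lemma exceeding_gt p s : all (fun x => p < x) (exceeding p s).
Proof.
elim: s p => //= x s IHs p; rewrite all_cat; apply/andP; split.
  by case: ifP => //= ->.
by apply: sub_all (IHs p.+1) => y; apply: ltnW.
Qed.

Lemma exceeding_succ p s : exceeding p.+1 (map S s) = map S (exceeding p s).
Proof. by elim: s p => //= x s IHs p; rewrite map_cat IHs ltnS; case: ifP. Qed.

Lemma exceeding_replace p v s :
  exceeding p.+1 [seq if x == v then 1 else x | x <- s] =
  [seq x <- exceeding p.+1 s | x != v].
Proof.
elim: s p => //= x s IHs p; rewrite filter_cat IHs; congr (_ ++ _).
by have [-> | neq_xv] := eqVneq x v; case: ifP => //= _; rewrite ?eqxx ?neq_xv.
Qed.

(** Reading s as an injective partial map, the points are renumbered to free the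
    point 1, which is then mapped to v.  If v was the image of some point, that
    point is redirected to 1: in cycle notation 1 is inserted on the arrow
    pointing to v.  For v = 1, a fixed point is created. *)
Definition graft (v : nat) (s : seq nat) :=
  v :: [seq if x == v then 1 else x | x <- map S s].

(** The arrow 1 -> v is an excedance unless v = 1, whereas an arrow to 1 never
    is one.  So the number of excedances grows by one, except when v = 1 or when
    the redirected arrow was an excedance. *)
Lemma exc_graft v s : 0 < v -> uniq s ->
  exc (graft v s) = exc s + (v \notin 1 :: map S (exceeding 1 s)).
Proof.
move=> v_gt0 s_uniq; rewrite !exc_exceeding /= exceeding_replace exceeding_succ.
set E := exceeding 1 s; have E_uniq : uniq (map S E).
  rewrite map_inj_uniq; last exact: succn_inj.
  exact: subseq_uniq (exceeding_subseq _ _) s_uniq.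
rewrite size_cat size_filter in_cons negb_or -(size_map S E).
have := count_predC (pred1 v) (map S E); rewrite count_uniq_mem // => <-.
have := allP (exceeding_gt 1 s); rewrite -/E => E1.
have [-> | v1] := eqVneq v 1.
  rewrite /= addn0 (_ : 1 \in _ = false) //.
  by apply/negbTE/mapP => -[y /E1] ? [] ?; subst.
rewrite (_ : 1 < v) /=; last by lia.
by case: (v \in _); rewrite ?addn0 ?add0n 1?addnC.
Qed.

(** * Equal growth of the two statistics *)

Lemma perm_map_indicator (T : Type) (a : pred T) c (s : seq T) :
  perm_eq [seq c + ~~ a x | x <- s]
          (nseq (count a s) c ++ nseq (size s - count a s) c.+1).
Proof.
rewrite -(count_predC a s) addKn; apply/permP=> b.
rewrite count_cat !count_nseq count_map.
elim: s => [|x s IHs] /=; first by lia.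
by rewrite IHs; case: (a x) => /=; rewrite ?addn0 ?addn1; lia.
Qed.

Lemma perm_flatten_map (S T : eqType) (st : S -> T) (ext : S -> seq S)
    (step : T -> seq T) (s : seq S) :
    {in s, forall x, perm_eq (map st (ext x)) (step (st x))} ->
  perm_eq (map st (flatten (map ext s))) (flatten (map step (map st s))).
Proof.
elim: s => //= x s IHs hs; rewrite map_cat perm_cat ?hs ?mem_head // IHs //.
by move=> y ys; apply: hs; rewrite in_cons ys orbT.
Qed.

(** The statistics of the extensions of an object whose statistic is c: of the N
    extensions, c keep the value c and the others have the value c + 1. *)
Definition growth N c := nseq c c ++ nseq (N - c) c.+1.

Fixpoint words m l :=
  if l is l'.+1 then
    [seq insert_at g l'.+2 w | w <- words m l', g <- iota 0 (m + l').+1]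
  else [:: nseq m 1].

Fixpoint injections m l :=
  if l is l'.+1 then
    [seq graft v s | s <- injections m l', v <- iota 1 (m + l').+1]
  else [:: [::]].

Lemma perm_insert_at g x w : perm_eq (insert_at g x w) (x :: w).
Proof. by rewrite /insert_at -cat1s perm_catCA /= cat_take_drop. Qed.

Lemma insert_at_rem (x : nat) (w : seq nat) :
  x \in w -> insert_at (index x w) x (rem x w) = w.
Proof.
move=> /split_first[P [R [-> xP]]].
rewrite remE index_cat (negPf xP) /= eqxx addn0 take_size_cat //.
rewrite -cat_rcons drop_size_cat ?size_rcons //.
by rewrite /insert_at take_size_cat // drop_size_cat // cat_rcons.
Qed.

Lemma insert_atK (x g : nat) (w : seq nat) : x \notin w -> g <= size w ->
  index x (insert_at g x w) = g /\ rem x (insert_at g x w) = w.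
Proof.
move=> xw gw; have xP : x \notin take g w by apply: contra xw => /mem_take.
have idx : index x (insert_at g x w) = g.
  by rewrite /insert_at index_cat (negPf xP) /= eqxx addn0 size_takel.
split=> //; rewrite remE idx /insert_at take_size_cat ?size_takel //.
by rewrite -cat_rcons drop_size_cat ?size_rcons ?size_takel // cat_take_drop.
Qed.

Lemma mem_words m l w :
  (w \in words m l) = perm_eq w (nseq m 1 ++ iota 2 l).
Proof.
elim: l w => [|l IHl] w.
  rewrite cats0 inE; apply/eqP/idP=> [-> // | w1].
  have /all_pred1P -> : all (pred1 1) w.
    by rewrite (perm_all _ w1) all_nseq orbT.
  by rewrite (perm_size w1) size_nseq.
have last_letter :
    perm_eq (nseq m 1 ++ iota 2 l.+1) (l.+2 :: nseq m 1 ++ iota 2 l).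
  by rewrite -{1}(addn1 l) iotaD catA cats1 perm_rcons add2n.
rewrite (permPr last_letter).
apply/allpairsP/idP=> [[[w' g] /= [ww _ ->]] | pw].
  by rewrite (permPl (perm_insert_at _ _ _)) perm_cons -IHl.
have lw : l.+2 \in w by rewrite (perm_mem pw) mem_head.
exists (rem l.+2 w, index l.+2 w); split; last by rewrite insert_at_rem.
  by rewrite /= IHl -(perm_cons l.+2) -(permPl (perm_to_rem lw)).
rewrite mem_iota /= add0n; move: lw; rewrite -index_mem (perm_size pw) /=.
by rewrite size_cat size_nseq size_iota.
Qed.

Lemma words_uniq m l : uniq (words m l).
Proof.
elim: l => // l IHl; apply: allpairs_uniq => //; first exact: iota_uniq.
have ok p : p \in [seq (w, g) | w <- words m l, g <- iota 0 (m + l).+1] ->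
    l.+2 \notin p.1 /\ p.2 <= size p.1.
  case/allpairsP=> -[w g] [ww gm ->]; rewrite /= mem_words in ww *.
  rewrite mem_iota /= in gm.
  rewrite (perm_size ww) (perm_mem ww) size_cat size_nseq size_iota.
  by rewrite mem_cat mem_nseq mem_iota; split; lia.
move=> [w g] [w' g'] /ok /= [nw gw] /ok /= [nw' gw'] eq_ins.
have [g_eq w_eq] := insert_atK nw gw.
have [g'_eq w'_eq] := insert_atK nw' gw'.
by congr (_, _); [rewrite -w_eq -w'_eq eq_ins | rewrite -g_eq -g'_eq eq_ins].
Qed.

(** Of the gaps, those that are descents keep the number of descents. *)
Lemma perm_des_words m l :
  perm_eq (map des (words m l.+1))
          (flatten (map (growth (m + l).+1) (map des (words m l)))).
Proof.
apply: perm_flatten_map => w; rewrite mem_words => pw.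
have size_w : size w = m + l.
  by rewrite (perm_size pw) size_cat size_nseq size_iota.
have w_lt : all (fun y => y < l.+2) w.
  rewrite (perm_all _ pw) all_cat all_nseq orbT; apply/allP=> y.
  by rewrite mem_iota add2n => /andP[].
rewrite -map_comp (eq_map (g := fun g => des w + ~~ descent_gap w g)).
  2: by move=> g /=; apply: des_insert_at.
have := perm_map_indicator (descent_gap w) (des w) (iota 0 (m + l).+1).
by rewrite size_iota -size_w count_descent_gap.
Qed.

Definition ungraft (t : seq nat) :=
  if t is v :: t' then (v, [seq (if x == 1 then v else x).-1 | x <- t'])
  else (0, [::]).

Lemma graftK v s : 0 < v -> all (leq 1) s -> ungraft (graft v s) = (v, s).
Proof.
move=> v_gt0 /allP s_gt0; congr (_, _); rewrite -!map_comp.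
apply: map_id_in => x /s_gt0 x_gt0 /=.
have [<- // | _] := eqVneq x.+1 v; by rewrite eqSS (gtn_eqF x_gt0).
Qed.

Lemma ungraftK v t : uniq (v :: t) -> all (leq 1) (v :: t) ->
  graft v (ungraft (v :: t)).2 = v :: t.
Proof.
rewrite /graft /= => /andP[vt _] /andP[v_gt0 /allP t_gt0].
congr (_ :: _); rewrite -!map_comp; apply: map_id_in => x xt /=.
have [-> | x1] := eqVneq x 1; first by rewrite prednK // eqxx.
rewrite prednK; last exact: t_gt0.
by case: eqP => // xv; rewrite -xv xt in vt.
Qed.

Lemma mem_injections m l s :
  (s \in injections m l) =
  [&& size s == l, all (fun x => 1 <= x <= m + l) s & uniq s].
Proof.
elim: l s => [|l IHl] s; first by rewrite inE; case: s.
apply/allpairsP/idP=> [[[s' v] [ss vm ->]] | ].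
  rewrite mem_iota /= in vm; move: ss; rewrite /= IHl.
  case/and3P=> /eqP sz /allP rng us; rewrite /= !size_map sz eqxx /=.
  rewrite -map_comp; apply/and3P; split.
  - apply/andP; split; first by lia.
    by apply/allP=> _ /mapP[x /rng /= xr ->]; case: ifP => _; lia.
  - by apply/mapP=> -[x /rng /= xr] /=; case: eqP; lia.
  rewrite map_inj_in_uniq // => x y /rng /= xr /rng /= yr /=.
  by case: eqP; case: eqP; lia.
case: s => [|v t] //= /and3P[/eqP[sz] /andP[vr /allP rng] /andP[vt ut]].
have gK : graft v (ungraft (v :: t)).2 = v :: t.
  apply: ungraftK; rewrite /= ?vt // (_ : 0 < v); last by lia.
  by apply/allP=> x /rng /andP[].
exists ((ungraft (v :: t)).2, v); split; last by rewrite gK.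
  2: by rewrite inE mem_iota /=; lia.
rewrite /= IHl /= size_map sz eqxx /=; apply/andP; split.
  apply/allP=> _ /mapP[x xt ->]; have xr := rng x xt.
  have xv : x != v by apply: contraNneq vt => <-.
  by case: eqP; lia.
rewrite map_inj_in_uniq // => x y xt yt /=.
have xr := rng x xt; have yr := rng y yt.
have xv : x != v by apply: contraNneq vt => <-.
have yv : y != v by apply: contraNneq vt => <-.
by case: eqP; case: eqP; lia.
Qed.

Lemma injections_uniq m l : uniq (injections m l).
Proof.
elim: l => // l IHl; apply: allpairs_uniq => //; first exact: iota_uniq.
have ok p : p \in [seq (s, v) | s <- injections m l, v <- iota 1 (m + l).+1] ->
    0 < p.2 /\ all (leq 1) p.1.
  case/allpairsP=> -[s v] [ss vm ->]; rewrite mem_iota /= in vm.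
  move: ss; rewrite /= mem_injections => /and3P[_ rng _]; split; first by lia.
  by apply: sub_all rng => x /andP[].
move=> [s v] [s' v'] /ok /= [v_gt0 s_gt0] /ok /= [v'_gt0 s'_gt0] eq_graft.
have := graftK v_gt0 s_gt0; rewrite [graft v s]eq_graft graftK //.
by case=> -> ->.
Qed.

(** The number of excedances is kept by v = 1 and by the excedance values, which
    makes one more than the number of excedances: this is the reason for the
    shift by one. *)
Lemma perm_exc_injections m l :
  perm_eq (map (S \o exc) (injections m l.+1))
          (flatten (map (growth (m + l).+1) (map (S \o exc) (injections m l)))).
Proof.
apply: perm_flatten_map => s; rewrite mem_injections => /and3P[_ rng us].
set E := 1 :: map S (exceeding 1 s).
rewrite -map_comp.
have /eq_in_map -> : {in iota 1 (m + l).+1, (S \o exc) \o graft^~ s =1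
                                           fun v => (exc s).+1 + (v \notin E)}.
  by move=> v; rewrite mem_iota => /andP[v_gt0 _] /=; rewrite exc_graft.
set r := iota 1 (m + l).+1.
have -> : growth (m + l).+1 ((S \o exc) s) =
    nseq (count (mem E) r) (exc s).+1 ++
    nseq (size r - count (mem E) r) (exc s).+2.
  rewrite /growth size_iota (_ : count _ _ = (exc s).+1) //.
  rewrite exc_exceeding -size_filter -(size_map S) -[RHS]/(size E).
  apply/perm_size/uniq_perm; first by rewrite filter_uniq ?iota_uniq.
    rewrite /E /= map_inj_uniq; last exact: succn_inj.
    rewrite (subseq_uniq (exceeding_subseq _ _) us) andbT.
    by apply/mapP=> -[y /(allP (exceeding_gt 1 s))]; lia.
  move=> v; rewrite mem_filter mem_iota; apply: andb_idr.
  rewrite inE => /predU1P[-> | /mapP[y yE ->]]; first by lia.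
  by have := allP rng y (mem_subseq (exceeding_subseq _ _) yE); lia.
exact: perm_map_indicator.
Qed.

Lemma perm_des_exc m l : 0 < m ->
  perm_eq (map des (words m l)) (map (S \o exc) (injections m l)).
Proof.
move=> m_gt0; elim: l => [|l IHl].
  have -> : map des (words m 0) = [:: 1].
    rewrite /= des_descents -[m in nseq m 1]prednK //=; congr [:: _].
    by rewrite descents_cons; elim: m.-1.
  by rewrite /= exc_exceeding.
rewrite (perm_trans (perm_des_words m l)) // perm_sym.
rewrite (perm_trans (perm_exc_injections m l)) // perm_sym.
exact/perm_flatten/perm_map.
Qed.

(** A crossing needs two letters that both occur at least twice. *)
Lemma noncrossing_words m l w : w \in words m l -> noncrossing w.
Proof.
rewrite mem_words => pw a b abw; apply/eqP; apply: contraT => neq_ab.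
have two c : c \in [:: a; b] -> c = 1.
  move=> cab; apply/eqP; apply: contraT => c1.
  have := leq_count_subseq (pred1 c) abw.
  rewrite (permP pw) count_cat count_nseq /= [1 == c]eq_sym (negPf c1).
  rewrite mul0n add0n.
  rewrite count_uniq_mem ?iota_uniq // => /leq_trans/(_ (leq_b1 _)).
  move: cab neq_ab; rewrite !inE => /orP[/eqP<-|/eqP<-]; rewrite eqxx; lia.
have a1 : a = 1 by apply: two; rewrite mem_head.
have b1 : b = 1 by apply: two; rewrite inE mem_head orbT.
by rewrite a1 b1 in neq_ab.
Qed.

Lemma equinumerous_stat (S T : eqType) (x0 : S) (y0 : T) (f : S -> nat)
    (g : T -> nat) (s : seq S) (t : seq T) (D : nat) :
    uniq s -> uniq t -> perm_eq (map f s) (map g t) ->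
  equinumerous (fun x => (x \in s) && (f x == D))
               (fun y => (y \in t) && (g y == D)).
Proof.
move=> s_uniq t_uniq fg.
have sz : size [seq x <- s | f x == D] = size [seq y <- t | g y == D].
  by rewrite !size_filter -(count_map f (pred1 D)) (permP fg) count_map.
have := equinumerous_seq x0 y0 (filter_uniq _ s_uniq) (filter_uniq _ t_uniq) sz.
move=> eq_st; apply: equinumerous_trans (equinumerous_trans _ eq_st) _.
- by apply: equinumerous_iff => x; rewrite mem_filter andbC.
- by apply: equinumerous_iff => y; rewrite mem_filter andbC.
Qed.

Theorem theorem1p3 (n : nat) (hn : 1 <= n) (k : 'I_n -> nat)
    (hk : forall i : 'I_n, 1 <= k i) (d : nat) :
  let K := \sum_(i < n) k i in
  exists f : {w : seq nat | quasi_stirling_perm k w && (des w == d + 1)} ->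
             {s : seq nat | partial_perm K (K - n + 1) s && (exc s == d)},
    bijective f.
Proof.
move=> K; apply: equinumerous_sig.
set M := flatten [seq nseq (k i) i.+1 | i <- enum 'I_n].
have sizeM : size M = K.
  rewrite size_flatten /shape -map_comp sumnE big_map /K big_enum /=.
  by apply: eq_bigr => i _; rewrite size_nseq.
have memM : M =i iota 1 n.
  move=> x; rewrite mem_iota; apply/flatten_mapP/idP => [[i _] | xn].
    by rewrite mem_nseq => /andP[_ /eqP->]; have := ltn_ord i; lia.
  have xn' : x.-1 < n by lia.
  exists (Ordinal xn'); first by rewrite mem_enum.
  by rewrite mem_nseq hk /= prednK ?eqxx //; lia.
have le_nK : n <= K.
  by rewrite /K -[n in n <= _]card_ord -sum1_card leq_sum.
set m := K - n.-1; have m_gt0 : 0 < m by rewrite /m; lia.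
apply: equinumerous_trans (equinumerous_iff (Q := qs M (d + 1)) _) _.
  move=> w; rewrite /quasi_stirling_perm /multiset_perm -/M.
  split=> [/andP[/andP[wM /quasi_stirlingP nc] /eqP] | [wM nc ->]].
    by split.
  by rewrite eqxx andbT; apply/andP; split=> //; apply/quasi_stirlingP.
apply: equinumerous_trans (equinumerous_normalize (d + 1) hn memM) _.
rewrite sizeM -/m.
pose W w := (w \in words m n.-1) && (des w == d + 1).
apply: equinumerous_trans (equinumerous_iff (Q := W) _) _.
  move=> w; rewrite /W; split=> [[pw _ des_w] | /andP[ww /eqP des_w]].
    by rewrite mem_words pw des_w eqxx.
  by split=> //; [rewrite -mem_words | apply: noncrossing_words ww].
have eq_stat := perm_des_exc n.-1 m_gt0.
have uniq_w := words_uniq m n.-1; have uniq_s := injections_uniq m n.-1.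
have eq_ws := equinumerous_stat [::] [::] (d + 1) uniq_w uniq_s eq_stat.
apply: equinumerous_trans eq_ws (equinumerous_iff _).
move=> s; rewrite mem_injections /partial_perm addn1 eqSS.
have -> : m + n.-1 = K by rewrite /m; lia.
by have -> : K - (K - n + 1) = n.-1 by lia.
Qed.
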